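(* When generating semimodular lattices by the recursive one-element extension procedure for canonical lattices (described in the context), it suffices to consider, for each lattice $L$ reached, only those lattice-antichains $A$ of $L$ that satisfy all of the following conditions, where $k$ is the number of levels of $L\setminus\{0\}$: (A1) $A\subseteq lev_{k-1}(L)$ or $A\subseteq lev_k(L)$; (A2) if $A\subseteq lev_k(L)$, then there are no atoms of $L$ in $lev_{k-1}(L)$; (A3) for all distinct $x,y\in A$, $x$ and $y$ have a common cover in $L$. That is: for every $N\geq 2$ and every canonical semimodular $N$-lattice $M$, there are canonical lattices $L_2,L_3,\ldots,L_N=M$, where $L_2$ is the two-element $2$-lattice and each $L_m$ is an $m$-lattice, and lattice-antichains $A_m$ of $L_m$ satisfying (A1), (A2) and (A3) (with $L=L_m$, $A=A_m$), such that $L_{m+1}=L_m^{A_m}$ for all $2\le m<N$.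
   Context: Write $a\prec b$ if $a$ is covered by $b$. A lattice is semimodular if for all $a,b$, $a\wedge b\prec a$ and $a\wedge b\prec b$ imply $a\prec a\vee b$ and $b\prec a\vee b$. An $n$-lattice ($n\ge 2$) is a lattice with underlying set $\{0,1,\ldots,n-1\}$ whose bottom is $0$ and whose top is $1$. For a subset $A$, ${\uparrow}A=\{b\mid b\geq a\text{ for some }a\in A\}$. A lattice-antichain of a lattice $L$ is a nonempty antichain $A\subseteq L\setminus\{0\}$ such that $a\wedge b\in\{0\}\cup{\uparrow}A$ for all $a,b\in{\uparrow}A$. Given an $n$-lattice $L$ and a lattice-antichain $A$ of $L$, $L^A$ is the $(n+1)$-lattice obtained by adding to $L$ a new element $n$ as an atom whose set of covers is $A$ (so $0<n$, $n<x$ iff $x\in{\uparrow}A$ for $x\in L$, and the order on $L$ is unchanged). Levels: for a finite poset $P$, $lev_1(P)$ is the set of maximal elements of $P$, and $lev_{m+1}(P)=lev_1(P\setminus\bigcup_{i=1}^m lev_i(P))$. For an $n$-lattice $L$, $k$ denotes the number of nonempty levels of $L\setminus\{0\}$, so $lev_k(L)$ is the bottom nonzero level (and $lev_j(L)=\emptyset$ for $j\le 0$). Canonical lattices: the weight of an $n$-lattice $L$ is $w(L)=(w_2(L),\ldots,w_{n-1}(L))$ with $w_i(L)=\sum_{i\prec j}2^j$ (sum over the covers $j$ of $i$ in $L$); weights are compared lexicographically. An $n$-lattice $C$ is canonical if no $n$-lattice isomorphic to $C$ has a smaller weight. Recursive procedure: starting from the two-element $2$-lattice, from each canonical $m$-lattice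 $L$ with $m$ less than the target size, form $L^A$ for each considered lattice-antichain $A$ of $L$, and continue recursively with those $L^A$ that are canonical. *)

(* Defs.v *)
From mathcomp Require Import all_boot all_order.

Set Implicit Arguments.
Unset Strict Implicit.
Unset Printing Implicit Defensive.

(** An order on {0, ..., n-1} is a boolean relation [r] on ['I_n], unrelated to
    the numerical order of the labels; [r x y] reads "x is below or equal to y
    in the lattice". *)

Section Lattices.
Variables (n : nat) (r : rel 'I_n).

Definition partial_order : Prop :=
  [/\ reflexive r, antisymmetric r & transitive r].

Definition is_meet (x y m : 'I_n) : Prop :=
  [/\ r m x, r m y & forall z, r z x -> r z y -> r z m].

Definition is_join (x y j : 'I_n) : Prop :=
  [/\ r x j, r y j & forall z, r x z -> r y z -> r j z].

Definition is_lattice : Prop :=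
  [/\ partial_order,
      forall x y, exists m, is_meet x y m &
      forall x y, exists j, is_join x y j].

Definition n_lattice : Prop :=
  [/\ 1 < n, is_lattice,
      forall x y : 'I_n, val x = 0 -> r x y &
      forall x y : 'I_n, val y = 1 -> r x y].

Definition strictly_below (x y : 'I_n) : bool := (x != y) && r x y.

Definition covered_by (x y : 'I_n) : bool :=
  strictly_below x y &&
  [forall z, ~~ (strictly_below x z && strictly_below z y)].

Definition semimodular : Prop :=
  forall a b m j, is_meet a b m -> is_join a b j ->
    covered_by m a -> covered_by m b -> covered_by a j /\ covered_by b j.

Definition atom (x : 'I_n) : Prop :=
  forall z : 'I_n, val z = 0 -> covered_by z x.

Definition nonzero : {set 'I_n} := [set x : 'I_n | val x != 0].

Definition up_set (A : {set 'I_n}) : {set 'I_n} :=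
  [set b | [exists a in A, r a b]].

Definition antichain (A : {set 'I_n}) : Prop :=
  forall x y, x \in A -> y \in A -> r x y -> x = y.

Definition lattice_antichain (A : {set 'I_n}) : Prop :=
  [/\ A != set0, A \subset nonzero, antichain A &
      forall a b m, a \in up_set A -> b \in up_set A -> is_meet a b m ->
        val m = 0 \/ m \in up_set A].

Definition maximal_elements (P : {set 'I_n}) : {set 'I_n} :=
  [set x in P | [forall y in P, ~~ strictly_below x y]].

(** [upper_levels P m] is the union of the levels 1, ..., m of [P]. *)
Fixpoint upper_levels (P : {set 'I_n}) (m : nat) : {set 'I_n} :=
  if m is m'.+1 then
    upper_levels P m' :|: maximal_elements (P :\: upper_levels P m')
  else set0.

(** Levels are numbered from 1, starting at the top. Level 0 is empty, so that
    the truncated predecessor below is harmless when there is one level only. *)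
Definition lev (P : {set 'I_n}) (m : nat) : {set 'I_n} :=
  if m is m'.+1 then maximal_elements (P :\: upper_levels P m') else set0.

(** Levels are disjoint and a nonempty one is preceded by nonempty ones only,
    so those of index greater than [n] are all empty. *)
Definition num_levels (P : {set 'I_n}) : nat :=
  count (fun m => lev P m != set0) (iota 1 n).

Definition cond_A1 (A : {set 'I_n}) : Prop :=
  let k := num_levels nonzero in
  A \subset lev setT k.-1 \/ A \subset lev setT k.

Definition cond_A2 (A : {set 'I_n}) : Prop :=
  let k := num_levels nonzero in
  A \subset lev setT k -> forall x, x \in lev setT k.-1 -> ~ atom x.

Definition cond_A3 (A : {set 'I_n}) : Prop :=
  forall x y, x \in A -> y \in A -> x != y ->
    exists z, covered_by x z /\ covered_by y z.

Definition weight_at (i : 'I_n) : nat := \sum_(j | covered_by i j) 2 ^ j.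

(** The sequence of the weights of the elements 2, ..., n-1, in this order;
    [seqlexi] carries the lexicographic order. *)
Definition weight : seqlexi nat :=
  [seq weight_at i | i : 'I_n <- enum 'I_n & 2 <= i].

(** [None] stands for the new element n; [Some x] for the old element x, whose
    label does not change since [lift ord_max] preserves values. *)
Definition extension (A : {set 'I_n}) : rel 'I_n.+1 := fun x y =>
  match unlift ord_max x, unlift ord_max y with
  | Some x', Some y' => r x' y'
  | Some x', None => val x' == 0
  | None, Some y' => y' \in up_set A
  | None, None => true
  end.

End Lattices.

Definition isomorphic n (r s : rel 'I_n) : Prop :=
  exists2 f : 'I_n -> 'I_n, bijective f & {mono f : x y / r x y >-> s x y}.

Definition canonical n (r : rel 'I_n) : Prop :=
  n_lattice r /\
  forall s : rel 'I_n, n_lattice s -> isomorphic r s ->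
    ~ (weight s < weight r)%O.

Definition two_lattice : rel 'I_2 := fun x y => x <= y.

(* Main.v *)
Require Import Defs.
From mathcomp Require Import all_boot all_order.
From mathcomp Require Import perm zify.

(** Minimality of the weight forces the labels of the nonzero elements of a
    canonical lattice [M] to increase with depth, the length of a longest chain
    to the top. Hence the labels [1, ..., m-1] form a filter of [M] for every
    [m], which together with [0] is a lattice [L m]; it is canonical, because
    an improving relabelling of it, extended by the identity, would improve [M].
    Passing from [L m] to [L m.+1] adds the element [m] below the set [A m] of
    its covers. If [M] is semimodular, then depth is a grading, so [A m] lies in
    a single level, the one just above [m] (A1). If that is the bottom level of
    [L m], then it is complete, so that no element of the level above it is an
    atom (A2). Finally two covers of [m] meet in [m], hence are covered by their
    join, which is in the filter (A3). *)

Set Implicit Arguments.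
Unset Strict Implicit.
Unset Printing Implicit Defensive.

(** * Weights: sums of powers of two and their lexicographic comparison *)

(** Binary expansion with exponents below [c]. Hence a weight whose covers all have labels below [c]
    is smaller than one with [c] among its covers. *)
Lemma sum_pow2_lt n (P : pred 'I_n) c :
  (forall j, P j -> j < c) -> \sum_(j | P j) 2 ^ j < 2 ^ c.
Proof.
elim: c P => [|c IHc] P ltPc; first by rewrite big_pred0 // => j; apply/negP => /ltPc.
rewrite expnS mul2n -addnn.
case: (pickP (fun j : 'I_n => P j && (val j == c))) => [j0 /andP[Pj0 /eqP j0c]|noc].
  rewrite (bigD1 j0) //= j0c ltn_add2l; apply: IHc => j /andP[/ltPc].
  by rewrite ltnS leq_eqVlt -val_eqE j0c; case: eqP.
apply: ltn_addr; apply: IHc => j Pj; move: (ltPc j Pj) (noc j).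
by rewrite Pj ltnS leq_eqVlt /=; case: eqP.
Qed.

Lemma lexi_mapP (T : Type) (s : seq T) (f g : T -> nat) (x0 : T) :
  ([seq f i | i <- s] < [seq g i | i <- s] :> seqlexi nat)%O <->
  exists k, [/\ k < size s, f (nth x0 s k) < g (nth x0 s k) &
                forall l, l < k -> f (nth x0 s l) = g (nth x0 s l)].
Proof.
elim: s => [|x s IHs] /=; first by split=> // -[k []].
rewrite Order.SeqLexiOrder.Exports.ltxi_cons !leEnat; split.
  case/andP=> lefg /implyP legf; case: (ltngtP (f x) (g x)) lefg => // [ltfg|eqfg] _.
    by exists 0.
  have /IHs[k [ltk ltfg eqfgk]] :
      ([seq f i | i <- s] < [seq g i | i <- s] :> seqlexi nat)%O.
    by apply: legf; rewrite eqfg.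
  by exists k.+1; split=> // -[|l] //=; apply: eqfgk.
case=> -[|k] /= [ltk ltfg eqfg]; first by rewrite (ltnW ltfg) leqNgt ltfg.
have /= eq0 := eqfg 0 isT; rewrite eq0 leqnn /=; apply/IHs.
by exists k; split=> // l ltl; apply: (eqfg l.+1).
Qed.

(** Labels at least 2 are enumerated in increasing order, so a first difference by position is a
    first difference by label. *)
Lemma weight_ltP n (r s : rel 'I_n) :
  (weight s < weight r)%O <->
  exists i : 'I_n, [/\ 2 <= i, weight_at s i < weight_at r i &
    forall j : 'I_n, 2 <= j < i -> weight_at s j = weight_at r j].
Proof.
pose e := [seq i : 'I_n <- enum 'I_n | 2 <= i].
have tr : transitive (fun i j : 'I_n => i < j) by move=> ? ? ?; apply: ltn_trans.
have sorted_e : sorted (fun i j : 'I_n => i < j) e.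
  apply: sorted_filter => //.
  have := iota_ltn_sorted 0 n; rewrite -val_enum_ord sorted_map.
  by apply: sub_sorted.
have mem_e i : (i \in e) = (2 <= i) by rewrite mem_filter mem_enum andbT.
have lt_nth x0 := sorted_ltn_nth tr x0 sorted_e.
split=> [|[i [i2 lti eqi]]].
  case: (pickP (@predT 'I_n)) => [x0 _|no]; last first.
    have e0 : e = [::] by case: (e) => // i ?; have := no i.
    by rewrite /weight -/e e0.
  case/(lexi_mapP _ _ _ x0) => k [ltk lts eqs]; exists (nth x0 e k); split=> //.
    by rewrite -mem_e mem_nth.
  move=> j /andP[j2 ltj]; have je : j \in e by rewrite mem_e.
  rewrite -(nth_index x0 je); apply: eqs; rewrite ltnNge; apply/negP => lek.
  have := je; rewrite -index_mem => ltj'.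
  move: lek; rewrite leq_eqVlt => /orP[/eqP ek|ltkj].
    by move: ltj; rewrite ek nth_index ?ltnn.
  have := lt_nth x0 _ _ ltk ltj' ltkj; rewrite nth_index // => /(ltn_trans ltj).
  by rewrite ltnn.
apply/(lexi_mapP _ _ _ i); have ie : i \in e by rewrite mem_e.
exists (index i e); split; rewrite ?index_mem ?nth_index // => l ltl; apply: eqi.
have ltle : l < size e by apply: ltn_trans ltl _; rewrite index_mem.
rewrite -mem_e mem_nth //=; have := lt_nth i _ _ ltle _ ltl.
by rewrite inE index_mem nth_index //; apply.
Qed.

(** * Depth in a finite poset, and levels *)

Section Depth.
Variables (n : nat) (r : rel 'I_n).

(** [k] is fuel. With enough of it a maximal element gets depth 1, in accordance with the numbering
    of levels. *)
Fixpoint depth_upto k (x : 'I_n) : nat :=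
  if k is k'.+1 then (\max_(y | strictly_below r x y) depth_upto k' y).+1 else 0.

Definition depth := depth_upto n.

Hypothesis r_po : partial_order r.

Lemma strictly_below_le_trans x y z :
  strictly_below r x y -> r y z -> strictly_below r x z.
Proof.
case: r_po => _ anti tr /andP[nxy rxy] ryz; rewrite /strictly_below (tr y) // andbT.
by apply: contra nxy => /eqP exz; apply/eqP/anti; rewrite rxy exz.
Qed.

(** Principal filters shrink strictly along [strictly_below], so the size of the filter of [x] is
    enough fuel. *)
Lemma depth_upto_stable k l x :
  #|[set y | r x y]| <= k -> #|[set y | r x y]| <= l -> depth_upto k x = depth_upto l x.
Proof.
case: r_po => refl _ _.
elim: k l x => [|k IHk] [|l] x //=.
- by rewrite leqn0 cards_eq0 => /eqP/setP/(_ x); rewrite !inE refl.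
- by rewrite leqn0 cards_eq0 => _ /eqP/setP/(_ x); rewrite !inE refl.
move=> lek lel; congr _.+1; apply: eq_bigr => y xy.
have ltyx : #|[set z | r y z]| < #|[set z | r x z]|.
  apply: proper_card; apply/properP; split.
    by apply/subsetP => z; rewrite !inE => /(strictly_below_le_trans xy)/andP[].
  exists x; rewrite !inE ?refl //; apply/negP => /(strictly_below_le_trans xy).
  by rewrite /strictly_below eqxx.
by apply: IHk; rewrite -ltnS; apply: leq_trans ltyx _.
Qed.

Lemma depthE x : depth x = (\max_(y | strictly_below r x y) depth y).+1.
Proof.
rewrite /depth (@depth_upto_stable n n.+1) //.
  by apply: leq_trans (max_card _) _; rewrite card_ord.
by apply: leqW; apply: leq_trans (max_card _) _; rewrite card_ord.
Qed.

Lemma depth_gt0 x : 0 < depth x.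
Proof. by rewrite depthE. Qed.

Lemma depth_lt x y : strictly_below r x y -> depth y < depth x.
Proof. by move=> xy; rewrite (depthE x) ltnS; apply: leq_bigmax_cond. Qed.

Lemma depth_pred x :
  1 < depth x -> exists2 y, strictly_below r x y & (depth y).+1 = depth x.
Proof.
rewrite depthE ltnS => lt0.
have [|y xy ey] := eq_bigmax_cond (A := strictly_below r x) depth.
  rewrite lt0n; apply/negP => /eqP/card0_eq e0.
  by move: lt0; rewrite big_pred0.
by exists y => //; rewrite -ey.
Qed.

Lemma covered_succ x y :
  strictly_below r x y -> (depth y).+1 = depth x -> covered_by r x y.
Proof.
move=> xy e; rewrite /covered_by xy; apply/forallP => z; apply/negP => /andP[xz zy].
by have := depth_lt xz; have := depth_lt zy; lia.
Qed.

Lemma cover_below x y : strictly_below r x y -> exists2 z, covered_by r x z & r z y.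
Proof.
case: (r_po) => refl _ tr xy.
pose P z := strictly_below r x z && r z y.
have Py : P y by rewrite /P xy refl.
case: (arg_maxnP depth Py) => z /andP[xz zy] zmax; exists z => //.
rewrite /covered_by xz; apply/forallP => w; apply/negP => /andP[xw wz].
have /andP[_ rwz] := wz; have := zmax w.
by rewrite /P xw (tr z) // => /(_ isT); have := depth_lt wz; lia.
Qed.

Lemma cover_above x y : strictly_below r x y -> exists2 z, covered_by r z y & r x z.
Proof.
case: (r_po) => refl _ tr xy.
pose P z := r x z && strictly_below r z y.
have Px : P x by rewrite /P xy refl.
case: (arg_minnP depth Px) => z /andP[xz zy] zmin; exists z => //.
rewrite /covered_by zy; apply/forallP => w; apply/negP => /andP[zw wy].
have /andP[_ rzw] := zw; have := zmin w.
by rewrite /P wy (tr z) // => /(_ isT); have := depth_lt zw; lia.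
Qed.

End Depth.

(* The depth of an element of an up-closed set [Q] only depends on [Q], so the
   levels of [P], restricted to [Q], are those of any function satisfying the
   recursion for depth on [Q]. *)
Lemma upper_levelsE n (r : rel 'I_n) (P Q : {set 'I_n}) (d : 'I_n -> nat) k x :
  {in Q, forall x, 0 < d x} ->
  {in Q, forall x y, strictly_below r x y -> y \in Q /\ d y < d x} ->
  {in Q, forall x, 1 < d x -> exists2 y, strictly_below r x y & (d y).+1 = d x} ->
  Q \subset P -> x \in Q -> (x \in upper_levels r P k) = (d x <= k).
Proof.
move=> d0 dlt dpred /subsetP QP.
elim: k x => [|k IHk] x Qx /=; first by rewrite inE leqNgt d0.
rewrite !inE IHk // QP // andbT.
case: (leqP (d x) k) => [/leqW-> //|ltk] /=.
apply/forall_inP/idP => [maxx|led y].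
  rewrite leqNgt; apply/negP => lt2.
  have [|y xy dy] := dpred x Qx; first by lia.
  have [Qy _] := dlt _ Qx _ xy.
  have ltky : k < d y by lia.
  by have := maxx y; rewrite xy !inE IHk // QP // andbT -ltnNge => /(_ ltky).
rewrite inE => /andP[yk _]; apply/negP => xy; have [Qy dy] := dlt _ Qx _ xy.
by move: yk; rewrite IHk // -ltnNge; lia.
Qed.

Lemma levE n (r : rel 'I_n) (P Q : {set 'I_n}) (d : 'I_n -> nat) k x :
  {in Q, forall x, 0 < d x} ->
  {in Q, forall x y, strictly_below r x y -> y \in Q /\ d y < d x} ->
  {in Q, forall x, 1 < d x -> exists2 y, strictly_below r x y & (d y).+1 = d x} ->
  Q \subset P -> x \in Q -> (x \in lev r P k) = (d x == k).
Proof.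
move=> d0 dlt dpred QP Qx.
have ulE l := upper_levelsE l d0 dlt dpred QP Qx.
case: k => [|k] /=; first by rewrite inE -leqn0 leqNgt d0.
have := ulE k.+1; rewrite /= inE ulE eqn_leq => <-.
by case: (ltnP k (d x)) => [_|ledx] /=; rewrite ?andbT // 2!inE ulE ledx.
Qed.

(** * Relabelling a lattice by a permutation *)

Section Relabelling.
Variables (n : nat) (r : rel 'I_n) (h : 'I_n -> 'I_n).
Hypothesis h_inj : injective h.

Lemma covered_by_relabel x y :
  covered_by (fun u v => r (h u) (h v)) x y = covered_by r (h x) (h y).
Proof.
have [g _ gK] := injF_bij h_inj.
rewrite /covered_by /strictly_below (inj_eq h_inj); congr (_ && _).
apply/forallP/forallP => H z; last by have := H (h z); rewrite !(inj_eq h_inj).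
by have := H (g z); rewrite -(inj_eq h_inj x) -(inj_eq h_inj (g z)) !gK.
Qed.

Lemma n_lattice_relabel :
  n_lattice r -> (forall x : 'I_n, x < 2 -> h x = x) ->
  n_lattice (fun u v => r (h u) (h v)).
Proof.
have [g hK gK] := injF_bij h_inj.
case=> n1 [[refl anti tr] meets joins] bot top fix01; split=> //.
- split.
  + split; [by move=> x; apply: refl| |by move=> y x z; apply: tr].
    by move=> x y /anti/h_inj.
  + move=> x y; have [m [mx my mz]] := meets (h x) (h y); exists (g m).
    by split; rewrite ?gK // => z; apply: mz.
  + move=> x y; have [m [mx my mz]] := joins (h x) (h y); exists (g m).
    by split; rewrite ?gK // => z; apply: mz.
- by move=> x y x0; apply: bot; rewrite fix01 x0.
- by move=> x y y1; apply: top; rewrite fix01 y1.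
Qed.

(** Otherwise the relabelled order would be an isomorphic lattice whose weight first differs at [i],
    where it drops. The sums are over covers in [r], so that the relabelled order need not
    appear. *)
Lemma canonical_relabel (i : 'I_n) :
  canonical r -> (forall x : 'I_n, x < 2 -> h x = x) -> 2 <= i ->
  (forall j : 'I_n, 2 <= j < i ->
     \sum_(k | covered_by r (h j) (h k)) 2 ^ k = weight_at r j) ->
  weight_at r i <= \sum_(k | covered_by r (h i) (h k)) 2 ^ k.
Proof.
case=> r_lat r_min fix01 i2 eqw; rewrite leqNgt; apply/negP => ltw.
have [g hK gK] := injF_bij h_inj.
case: (r_min _ (n_lattice_relabel r_lat fix01)).
  by exists g; [exists h | move=> x y; rewrite !gK].
have weightE j :
    weight_at (fun u v => r (h u) (h v)) j = \sum_(k | covered_by r (h j) (h k)) 2 ^ k.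
  by apply: eq_bigl => k; rewrite covered_by_relabel.
by apply/weight_ltP; exists i; split=> // [|j jP]; rewrite weightE // eqw.
Qed.

End Relabelling.

(** * Labels and depth in a canonical lattice *)

Section Canonical.
Variables (n : nat) (r : rel 'I_n).
Hypothesis r_can : canonical r.

Let r_lat : n_lattice r. Proof. by case: r_can. Qed.

Lemma canonical_po : partial_order r.
Proof. by case: r_lat => _ []. Qed.
Let r_po := canonical_po.

Lemma le_bot (x y : 'I_n) : r x y -> val y = 0 -> val x = 0.
Proof.
case: r_lat r_po => _ _ bot _ [_ anti _] xy y0.
by rewrite (anti x y) // xy bot.
Qed.

(* Otherwise transposing [i] with an element of smaller depth and larger label
   would lower the weight at [i]: all covers of the latter have labels smaller
   than that of some cover of [i]. *)
Lemma canonical_depth_le (i j : 'I_n) : 0 < i < j -> depth r i <= depth r j.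
Proof.
have [m] := ubnP (val i); elim: m i j => // m IHm i j0 lti /andP[i0 ltij0].
rewrite leqNgt; apply/negP => ltd0.
have IH (a b : 'I_n) : 0 < a < i -> a < b -> depth r a <= depth r b.
  by case/andP=> a0 ai ab; apply: (IHm a b); [by apply: leq_trans ai _ | rewrite a0].
(* Among the labels above [i], take one of least depth: its covers, being less deep still, have
   labels at most [i]. *)
case: (arg_minnP (P := fun j : 'I_n => i < j) (depth r) ltij0) => j ltij jmin.
have {j0 ltij0 ltd0} ltd : depth r j < depth r i.
  by apply: leq_ltn_trans (jmin _ ltij0) ltd0.
have i2 : 1 < i.
  rewrite ltn_neqAle i0 andbT; apply/eqP => i1.
  have : strictly_below r j i.
    by rewrite /strictly_below -val_eqE neq_ltn ltij orbT; case: r_lat => _ _ _; apply.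
  by move/(depth_lt r_po); lia.
have [|c ic dc] := depth_pred r_po (_ : 1 < depth r i).
  by apply: leq_trans ltd; rewrite ltnS depth_gt0.
have c0 : 0 < c.
  rewrite lt0n; apply: contraTN i0 => /eqP c0.
  by rewrite -leqNgt leqn0 (le_bot _ c0) //; case/andP: ic.
have cov_lt a b : covered_by r a b -> depth r b < depth r a.
  by case/andP => /(depth_lt r_po).
pose h := tperm i j.
(* Covers are less deep, so an element no deeper than [j] is covered neither by [i] nor by [j], and
   the swap leaves its covers alone. *)
have hE a k : depth r a <= depth r j -> covered_by r a (h k) = covered_by r a k.
  move=> da; have nai : covered_by r a i = false by apply/negP => /cov_lt; lia.
  have naj : covered_by r a j = false by apply/negP => /cov_lt; lia.
  by rewrite /h; case: tpermP => [->|->|]; rewrite ?nai ?naj.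
suff ltw : weight_at r j < weight_at r i.
  move: ltw; rewrite ltnNge => /negP[].
  have -> : weight_at r j = \sum_(k | covered_by r (h i) (h k)) 2 ^ k.
    by rewrite /h tpermL; apply: eq_bigl => k; rewrite hE.
  apply: canonical_relabel => // [|x x2|a /andP[a2 ltai]]; first exact: perm_inj.
    by rewrite /h tpermD // -val_eqE /=; lia.
  rewrite /h tpermD; [|rewrite -val_eqE /=; lia..].
  by apply: eq_bigl => k; apply: hE; apply: IH; lia.
(* The cover [c] of [i] separates the two weights: it contributes [2 ^ c] at [i], while all covers
   of [j] have labels below [c]. *)
apply: (@leq_trans (2 ^ c)); last first.
  by rewrite /weight_at (bigD1 c) ?leq_addr // covered_succ.
(* A cover [e] of [j] with label at least [c] has label below [i], so by induction it is at least as
   deep as [c]; but [c] is at least as deep as [j]. *)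
apply: sum_pow2_lt => e /cov_lt de; rewrite ltnNge; apply/negP => lece.
have ltei : e < i.
  case: (ltngtP e i) => // [/jmin|/val_inj eei]; first by lia.
  by move: de; rewrite eei; lia.
have : depth r c <= depth r e; last by lia.
move: lece; rewrite leq_eqVlt => /orP[/eqP/val_inj-> //|ltce].
by apply: IH => //; lia.
Qed.

(** A strictly larger element is less deep, hence has a smaller label. This makes the labels
    [1, ..., m-1] a filter. *)
Lemma label_le (x y : 'I_n) : 0 < x -> r x y -> 0 < y <= x.
Proof.
move=> x0 xy; have y0 : 0 < y.
  by rewrite lt0n; apply: contraTN x0 => /eqP y0; rewrite -leqNgt leqn0 (le_bot xy).
rewrite y0 leqNgt; apply/negP => ltxy.
have : depth r x <= depth r y by apply: canonical_depth_le; rewrite ?x0.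
rewrite leqNgt => /negP[]; apply: depth_lt => //.
by rewrite /strictly_below xy -val_eqE /=; lia.
Qed.

(** Labels drop along a chain that realizes the depth. The bound keeps all nonempty levels within
    the range counted by [num_levels]. *)
Lemma depth_le_label (x : 'I_n) : 0 < x -> depth r x <= x.
Proof.
have [k] := ubnP (val x); elim: k x => // k IHk x ltxk x0.
have [|lt1] := leqP (depth r x) 1; first by move/leq_trans; apply.
have [y xy <-] := depth_pred r_po lt1.
have /andP[nxy lexy] := xy; have /andP[y0 ylex] := label_le x0 lexy.
have ltyx : y < x by rewrite ltn_neqAle ylex andbT val_eqE eq_sym.
by apply: leq_trans (ltyx); apply: IHk => //; apply: (leq_trans ltyx ltxk).
Qed.

Lemma depth_attained (x : 'I_n) k : 0 < x -> 0 < k <= depth r x ->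
  exists2 y : 'I_n, depth r y = k & 0 < y <= x.
Proof.
have [l] := ubnP (depth r x); elim: l x => // l IHl x ltxl x0 /andP[k0].
rewrite leq_eqVlt => /orP[/eqP->|ltkx]; first by exists x; rewrite ?x0 /=.
have [y xy dy] := depth_pred r_po (leq_ltn_trans k0 ltkx).
have /andP[_ /(label_le x0)/andP[y0 ylex]] := xy.
have [||z dz /andP[z0 zy]] := IHl y _ y0; [lia | by rewrite k0; lia |].
by exists z => //; rewrite z0 (leq_trans zy).
Qed.

End Canonical.

(** * Gradedness of semimodular lattices *)

(** Induction on the depth of [x]: compare [y] with a cover [z] of [x] one level up. Both are
    covered by their join, whose depth then forces theirs to agree. *)
Lemma semimodular_graded n (r : rel 'I_n) x y :
  is_lattice r -> semimodular r -> covered_by r x y -> depth r x = (depth r y).+1.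
Proof.
case=> r_po meets joins r_sm; case: (r_po) => refl anti tr.
have [m] := ubnP (depth r x); elim: m x y => // m IHm x y ltxm xy.
have /andP[sxy /forallP nxy] := xy.
have [|z sxz dz] := depth_pred r_po (_ : 1 < depth r x).
  by apply: leq_trans (depth_lt r_po sxy); rewrite ltnS depth_gt0.
have xz := covered_succ r_po sxz dz.
case: (eqVneq y z) => [-> //|nyz].
have [j yzj] := joins y z.
have xm : is_meet r y z x.
  have [w wm] := meets y z; case: (wm) => wy wz wmax.
  have xw : r x w by apply: wmax; [case/andP: sxy | case/andP: sxz].
  suff -> : x = w by [].
  (* A meet [w] strictly above [x] would equal [y], as [y] covers [x]; then [y] would lie strictly
     between [x] and [z]. *)
  apply/eqP; apply: contraTT xz => nxw; have ewy : w = y.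
    apply/eqP; apply: contraNT (nxy w) => nwy.
    by rewrite /strictly_below nxw xw nwy wy.
  rewrite ewy in wz; rewrite /covered_by negb_and; apply/orP; right.
  by apply/forallPn; exists y; rewrite sxy /strictly_below nyz wz.
have [yj zj] := r_sm _ _ _ _ xm yzj xy xz.
have dy := IHm _ _ (leq_trans (depth_lt r_po sxy) _ : _ < m) yj.
have dz' := IHm _ _ (leq_trans (depth_lt r_po sxz) _ : _ < m) zj.
by rewrite -dz dy ?dz' //; lia.
Qed.

(** * The sublattice of labels below [m] *)

(** [inord] keeps values up to [n] only, so this is meaningful for [m <= n.+1]; it is total in [m]
    to serve as the family in the theorem. *)
Definition restriction n (r : rel 'I_n.+1) m : rel 'I_m :=
  fun x y => r (inord x) (inord y).
Arguments restriction {n} r m.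

Lemma eq_covered_by n (r s : rel 'I_n) x y :
  r =2 s -> covered_by r x y = covered_by s x y.
Proof.
move=> ers; rewrite /covered_by /strictly_below ers; congr (_ && _).
by apply: eq_forallb => z; rewrite !ers.
Qed.

Section Restriction.
Variables (n m : nat) (M : rel 'I_n.+1).
Hypotheses (M_can : canonical M) (m2 : 1 < m) (mn : m <= n.+1).

Let M_lat : n_lattice M. Proof. by case: M_can. Qed.
Let M_po : partial_order M := canonical_po M_can.
Let emb (x : 'I_m) : 'I_n.+1 := inord x.
Local Notation L := (restriction M m).

Lemma val_inord_ord (x : 'I_m) : val (inord x : 'I_n.+1) = x.
Proof. by rewrite /= inordK // (leq_trans (ltn_ord x)). Qed.

Lemma inord_ord_inj : injective emb.
Proof. by move=> x y /(congr1 val); rewrite /emb !val_inord_ord => /val_inj. Qed.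

Lemma inord_ord_surj (y : 'I_n.+1) : y < m -> exists x : 'I_m, y = inord x.
Proof.
by move=> ym; exists (Ordinal ym); apply: val_inj; rewrite val_inord_ord.
Qed.

Lemma restriction_up (x : 'I_m) (y : 'I_n.+1) :
  0 < x -> M (inord x) y -> exists2 z : 'I_m, y = inord z & 0 < z <= x.
Proof.
move=> x0 /(label_le M_can); rewrite val_inord_ord => /(_ x0) yx.
have [|z zy] := @inord_ord_surj y; first by case/andP: yx => _ /leq_ltn_trans; apply.
by exists z; rewrite // -(val_inord_ord z) -zy.
Qed.

Lemma strictly_below_restriction x y :
  strictly_below L x y = strictly_below M (inord x) (inord y).
Proof. by rewrite /strictly_below (inj_eq inord_ord_inj). Qed.

(** Everything above a nonzero [x] stays in the filter. For the bottom this may fail: elements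
    outside the filter can lie below an atom of [L]. *)
Lemma covered_by_restriction (x y : 'I_m) :
  0 < x -> covered_by L x y = covered_by M (inord x) (inord y).
Proof.
move=> x0; rewrite /covered_by strictly_below_restriction; congr (_ && _).
apply/forallP/forallP => H z; last first.
  by have := H (inord z); rewrite !strictly_below_restriction.
apply/negP => /andP[xz zy]; have /andP[_ /(restriction_up x0)[w ew _]] := xz.
by have := H w; rewrite !strictly_below_restriction -ew xz zy.
Qed.

Lemma restriction_n_lattice : n_lattice L.
Proof.
case: (M_lat) => _ [[refl anti tr] meets joins] bot top.
have bot' (x y : 'I_m) : val x = 0 -> L x y.
  by move=> x0; apply: bot; rewrite val_inord_ord.
split=> //; last by move=> x y y1; apply: top; rewrite val_inord_ord.
split.
- split; [by move=> x; apply: refl| |by move=> y x z; apply: tr].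
  by move=> x y /anti/inord_ord_inj.
- move=> x y; have [w [wx wy wmax]] := meets (inord x) (inord y).
  have [ltwm|lemw] := ltnP w m.
    have [w' ew] := inord_ord_surj ltwm; subst w.
    by exists w'; split=> // z; apply: wmax.
  (* The meet [w] in [M] has been discarded, so the meet in [L] is 0: a nonzero common lower bound
     in [L] would put [w] into the filter. *)
  exists (Ordinal (ltnW m2)); split; try exact: bot'.
  move=> z zx zy; have [z0|z0] := posnP z; first exact: bot'.
  have [u uw /andP[_ uz]] := restriction_up z0 (wmax _ zx zy).
  by move: lemw; rewrite uw val_inord_ord; have := ltn_ord u; lia.
- move=> x y; have [x0|x0] := posnP x.
    by exists y; split=> //; [apply: bot' | apply: refl].
  have [w [xw yw wmin]] := joins (inord x) (inord y).
  have [w' ew _] := restriction_up x0 xw; subst w.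
  by exists w'; split=> // z; apply: wmin.
Qed.

Lemma sum_restriction (P : pred 'I_n.+1) :
  (forall k, P k -> k < m) -> \sum_(k | P k) 2 ^ k = \sum_(k : 'I_m | P (inord k)) 2 ^ k.
Proof.
move=> Pm; have eP k : P k = P k && (k < m) by case Pk : (P k) => //=; rewrite Pm.
rewrite (eq_bigl _ _ eP) (big_ord_narrow_cond mn); apply: eq_bigl => k.
by congr P; apply: val_inj; rewrite val_inord_ord.
Qed.

(** Weights concern nonzero elements only, whose covers are the same in [L] and [M]; so a lighter
    copy [s] of [L] yields a relabelling [h] of [M] with the same first drop. *)
Lemma restriction_canonical : canonical L.
Proof.
split; first exact: restriction_n_lattice.
move=> s s_lat [f [g fK gK] fmono] /weight_ltP[i [i2 lti eqi]].
have gmono x y : L (g x) (g y) = s x y by rewrite -fmono !gK.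
have g_inj := can_inj gK.
have g_fix (x : 'I_m) : x < 2 -> g x = x.
  case: restriction_n_lattice => _ [[_ anti _] _ _] bot top.
  case: s_lat => _ _ bots tops.
  rewrite ltnS leq_eqVlt ltnS leqn0 => /orP[]/eqP x01; apply: anti.
    by rewrite top // -fmono gK tops.
  by rewrite andbC bot // -fmono gK bots.
pose h (x : 'I_n.+1) : 'I_n.+1 := if insub (val x) is Some x' then inord (g x') else x.
have hE (x : 'I_m) : h (inord x) = inord (g x) by rewrite /h val_inord_ord valK.
have h_out (x : 'I_n.+1) : m <= x -> h x = x by rewrite /h leqNgt => ?; rewrite insubN.
have h_inj : injective h.
  have out_emb (x : 'I_m) (y : 'I_n.+1) : m <= y -> inord x <> y.
    by move=> lemy exy; move: lemy; rewrite -exy val_inord_ord leqNgt ltn_ord.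
  move=> x y; have [/inord_ord_surj[x' ->]|mx] := ltnP x m;
    have [/inord_ord_surj[y' ->]|my] := ltnP y m; rewrite ?hE ?h_out //.
  - by move/inord_ord_inj/g_inj->.
  - by move/(out_emb _ _ my).
  - by move/esym/(out_emb _ _ mx).
have h_fix (x : 'I_n.+1) : x < 2 -> h x = x.
  move=> x2; have [x' ex] := inord_ord_surj (leq_trans x2 m2); subst x.
  by rewrite hE g_fix // -val_inord_ord.
have g_gt0 (j : 'I_m) : 1 < j -> 0 < g j.
  move=> j2; have m0 := ltnW m2; rewrite lt0n; apply: contraTneq j2 => gj0.
  have gj : g j = Ordinal m0 by apply: val_inj.
  by have -> : j = Ordinal m0 by apply: g_inj; rewrite gj g_fix.
have sum_h (j : 'I_m) : 1 < j ->
    \sum_(k | covered_by M (h (inord j)) (h k)) 2 ^ k = weight_at s j.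
  move=> j2; rewrite sum_restriction => [|k].
    apply: eq_bigl => k; rewrite !hE -covered_by_restriction ?g_gt0 //.
    by rewrite -(covered_by_relabel _ g_inj); apply: eq_covered_by.
  (* A [k] outside the filter is fixed by [h], so it cannot lie above the nonzero element [g j]. *)
  rewrite hE => /andP[/andP[_]] jk _; rewrite ltnNge; apply/negP => mk.
  move: jk; rewrite h_out // => /restriction_up[|w kw _]; first exact: g_gt0.
  by move: mk; rewrite kw val_inord_ord leqNgt ltn_ord.
have weightE (j : 'I_m) : 0 < j -> weight_at L j = weight_at M (inord j).
  move=> j0; rewrite /weight_at sum_restriction => [|k].
    by apply: eq_bigl => k; rewrite covered_by_restriction.
  by case/andP=> /andP[_ /(restriction_up j0)[w -> _]] _; rewrite val_inord_ord.
have : weight_at M (inord i) <= \sum_(k | covered_by M (h (inord i)) (h k)) 2 ^ k.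
  apply: canonical_relabel => //; first by rewrite val_inord_ord.
  move=> j; rewrite val_inord_ord => /andP[j2 ltji].
  have [j' ej] := inord_ord_surj (ltn_trans ltji (ltn_ord i)); subst j.
  rewrite val_inord_ord in j2 ltji; rewrite sum_h // eqi ?j2 ?weightE //.
  exact: ltnW.
rewrite sum_h // -weightE; last exact: ltnW.
by rewrite leqNgt lti.
Qed.

(** [P] is left open because [num_levels] uses the levels of [nonzero] and the conditions those of
    [setT]. The bottom is excluded: it may be deeper in [M] than in [L]. *)
Lemma lev_restriction (P : {set 'I_m}) k (x : 'I_m) :
  nonzero m \subset P -> 0 < x -> (x \in lev L P k) = (depth M (inord x) == k).
Proof.
have nz (y : 'I_m) : (y \in nonzero m) = (0 < y) by rewrite inE lt0n.
move=> nzP x0; rewrite (@levE _ _ _ (nonzero m) (fun x => depth M (inord x))) ?nz //.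
- move=> y; rewrite nz => y0 z; rewrite strictly_below_restriction => yz.
  split; last exact: depth_lt.
  have /andP[_ /(restriction_up y0)[w /inord_ord_inj-> /andP[w0 _]]] := yz.
  by rewrite nz.
move=> y; rewrite nz => y0 lt1; have [z yz dz] := depth_pred M_po lt1.
have /andP[_ /(restriction_up y0)[w ew _]] := yz.
by exists w; rewrite ?strictly_below_restriction -ew.
Qed.

(** The last label is the deepest nonzero one, and every smaller positive depth is attained. *)
Lemma num_levels_restriction :
  num_levels L (nonzero m) = depth M (inord m.-1).
Proof.
have ltm : m.-1 < m by lia.
have lab : val (inord m.-1 : 'I_n.+1) = m.-1 by apply: inordK; lia.
set D := depth M _.
have leDm : D <= m.-1 by rewrite -lab; apply: (depth_le_label M_can); rewrite lab; lia.
have levP k : 0 < k -> (lev L (nonzero m) k != set0) = (k <= D).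
  move=> k0; apply/set0Pn/idP => [[x xk]|lekD].
    have x0 : 0 < x.
      move: xk; case: (k) => [|k'] /=; rewrite ?inE // => /andP[/andP[_]].
      by rewrite lt0n.
    move: xk; rewrite lev_restriction // => /eqP <-.
    have : x <= m.-1 by have := ltn_ord x; lia.
    rewrite leq_eqVlt => /orP[/eqP ex|ltx]; first by rewrite /D ex.
    by apply: canonical_depth_le; rewrite // lab val_inord_ord x0.
  have last0 : 0 < (inord m.-1 : 'I_n.+1) by rewrite lab; lia.
  have [|y dy] := depth_attained M_can last0 (_ : 0 < k <= _); first by rewrite k0.
  rewrite lab.
  case/andP=> y0 ylem; have [|z ez] := @inord_ord_surj y; first lia.
  by exists z; subst y; rewrite val_inord_ord in y0; rewrite lev_restriction // dy.
rewrite /num_levels (@eq_in_count _ _ (fun k => k <= D)) => [|k]; last first.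
  by rewrite mem_iota => /andP[k0 _]; apply: levP.
have -> : iota 1 m = iota 1 D ++ iota (1 + D) (m - D) by rewrite -iotaD; congr iota; lia.
rewrite count_cat (@eq_in_count _ _ predT) => [|k]; last by rewrite mem_iota /=; lia.
rewrite count_predT size_iota (@eq_in_count _ _ pred0) ?count_pred0 ?addn0 // => k.
by rewrite mem_iota /=; lia.
Qed.

End Restriction.

(** * Adding the label [m] below its covers *)

Definition cover_set n (r : rel 'I_n.+1) m : {set 'I_m} :=
  [set x : 'I_m | covered_by r (inord m) (inord x)].
Arguments cover_set {n} r m.

Section LastAtom.
Variables (n m : nat) (M : rel 'I_n.+1).
Hypotheses (M_can : canonical M) (m2 : 1 < m) (mn : m < n.+1).

Let M_lat : n_lattice M. Proof. by case: M_can. Qed.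
Let M_po : partial_order M := canonical_po M_can.
Let mn' : m <= n.+1 := ltnW mn.
Local Notation L := (restriction M m).
Local Notation A := (cover_set M m).
Local Notation a := (inord m : 'I_n.+1).

Lemma val_new : val a = m.
Proof. exact: inordK. Qed.

Lemma above_new (y : 'I_n.+1) : strictly_below M a y -> 0 < y < m.
Proof.
case/andP=> nay /(label_le M_can); rewrite val_new => /(_ (ltnW m2)) /andP[-> lym].
by rewrite ltn_neqAle lym andbT -val_new val_eqE eq_sym.
Qed.

Lemma below_new (y : 'I_n.+1) : 0 < y -> M y a -> m <= y.
Proof. by move=> y0 /(label_le M_can y0); rewrite val_new => /andP[]. Qed.

(** Anything strictly above the new element lies above one of its covers, and these have labels
    below [m]. *)
Lemma mem_up_set (y : 'I_m) : (y \in up_set L A) = M a (inord y).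
Proof.
case: (M_po) => refl anti tr; rewrite inE; apply/exists_inP/idP => [[x]|ay].
  by rewrite inE => /andP[/andP[_ ax] _]; apply: tr.
have say : strictly_below M a (inord y).
  rewrite /strictly_below ay andbT -val_eqE /= (val_inord_ord mn') inordK //.
  by have := ltn_ord y; lia.
have [z az zy] := cover_below M_po say.
have /andP[/above_new/andP[_ /(inord_ord_surj mn')[w ew]] _] := az; subst z.
by exists w => //; rewrite inE.
Qed.

Lemma cover_set_gt0 x : x \in A -> 0 < x.
Proof.
by rewrite inE => /andP[/above_new /andP[]]; rewrite (val_inord_ord mn').
Qed.

Lemma cover_set_neq0 : A != set0.
Proof.
have : Ordinal m2 \in up_set L A.
  by rewrite mem_up_set; case: M_lat => _ _ _; apply; apply: (val_inord_ord mn').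
by rewrite inE => /exists_inP[x xA _]; apply/set0Pn; exists x.
Qed.

Lemma cover_set_lattice_antichain : lattice_antichain L A.
Proof.
case: (M_lat) => _ [[refl anti tr] meets _] _ _.
split; first exact: cover_set_neq0.
- by apply/subsetP => x /cover_set_gt0; rewrite inE lt0n.
- move=> x y; rewrite !inE => /andP[ax _] /andP[_ /forallP/(_ (inord x))].
  rewrite ax /= => nxy xy; apply/(inord_ord_inj mn')/eqP.
  by apply: contraNT nxy => nexy; apply/andP.
move=> x y c; rewrite !mem_up_set => ax ay [cx cy cmax].
case: (posnP c) => [|c0]; [by left | right].
(* The meet [w] in [M] is above the new element, and also above the nonzero old [c], so it is not
   the new one. Hence it lies in [L] and below [c]. *)
have [w [wx wy wmax]] := meets (inord x) (inord y).
have aw := wmax _ ax ay; have cw := wmax _ cx cy.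
have [eaw|naw] := eqVneq a w.
  have := @below_new (inord c); rewrite (val_inord_ord mn') eaw => /(_ c0 cw).
  by rewrite leqNgt ltn_ord.
have /above_new/andP[_ /(inord_ord_surj mn')[z ez]] : strictly_below M a w.
  by rewrite /strictly_below naw.
by subst w; apply: tr aw _; apply: cmax.
Qed.

(** The new element is an atom because labels decrease going up: a nonzero element below it has
    label at least [m]. *)
Lemma extension_cover_set : restriction M m.+1 =2 extension L A.
Proof.
case: (M_po) => refl anti tr.
have new_E : inord (@ord_max m) = a by [].
have old_E (x : 'I_m) : inord (lift ord_max x) = inord x :> 'I_n.+1.
  by rewrite lift_max.
move=> x y; rewrite /extension /restriction.
case: unliftP => [x'|] ->; case: unliftP => [y'|] ->; rewrite ?new_E ?old_E //.
- apply/idP/eqP => [xa|x0]; last first.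
    by case: (M_lat) => _ _ bot _; apply: bot; rewrite (val_inord_ord mn').
  apply/eqP; rewrite -leqn0 leqNgt; apply/negP => x0.
  have := @below_new (inord x'); rewrite (val_inord_ord mn') => /(_ x0 xa).
  by rewrite leqNgt ltn_ord.
- by rewrite mem_up_set.
exact: refl.
Qed.

Hypothesis M_sm : semimodular M.

Let depth_cover x y : covered_by M x y -> depth M x = (depth M y).+1.
Proof. by apply: semimodular_graded => //; case: M_lat. Qed.

Lemma cover_set_depth x : x \in A -> (depth M (inord x)).+1 = depth M a.
Proof. by rewrite inE => /depth_cover. Qed.

Lemma mem_lev_restriction k (x : 'I_m) :
  0 < x -> (x \in lev L setT k) = (depth M (inord x) == k).
Proof. by move=> x0; apply: lev_restriction => //; apply: subsetT. Qed.

Let k := num_levels L (nonzero m).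

Let k_depth : k = depth M (inord m.-1).
Proof. exact: num_levels_restriction. Qed.

Lemma val_last : val (inord m.-1 : 'I_n.+1) = m.-1.
Proof. by apply: inordK; lia. Qed.

(* By gradedness all covers of the new element lie one level above it, which is
   level [k - 1] if the new element joins the bottom level, and [k] if it opens
   a new one. *)
Lemma num_levels_depth : k <= depth M a <= k.+1.
Proof.
have lt_last : 0 < (inord m.-1 : 'I_n.+1) < a.
  by have := val_last; have := val_new => /= -> ->; lia.
rewrite k_depth canonical_depth_le //=.
have /set0Pn[x xA] := cover_set_neq0; have x0 := cover_set_gt0 xA.
rewrite -(cover_set_depth xA) ltnS.
have : x <= m.-1 by have := ltn_ord x; lia.
rewrite leq_eqVlt => /orP[/eqP-> //|ltx].
by apply: canonical_depth_le => //; rewrite (val_inord_ord mn') x0 val_last.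
Qed.

Lemma cover_set_A1 : cond_A1 L A.
Proof.
rewrite /cond_A1 -/k; have /andP[kd dk] := num_levels_depth.
have [ek|nk] := eqVneq (depth M a) k; [left | right].
  apply/subsetP => x xA; have := cover_set_depth xA.
  by rewrite mem_lev_restriction ?cover_set_gt0 // ek => <-.
apply/subsetP => x xA; have := cover_set_depth xA.
rewrite mem_lev_restriction ?cover_set_gt0 //; lia.
Qed.

Lemma cover_set_A2 : cond_A2 L A.
Proof.
rewrite /cond_A2 -/k => /subsetP Ak x xk x_atom.
have /set0Pn[b bA] := cover_set_neq0.
have /eqP db : depth M (inord b) == k.
  by rewrite -mem_lev_restriction ?cover_set_gt0 ?Ak.
have da := cover_set_depth bA; rewrite db in da.
pose z : 'I_m := Ordinal (ltnW m2).
have zx : strictly_below L z x by have /andP[] := x_atom z erefl.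
have x0 : 0 < x.
  by rewrite lt0n; apply: contraTneq zx => x0; rewrite /strictly_below -val_eqE /= x0.
move: xk; rewrite mem_lev_restriction // => /eqP dx.
(* Positive depth shows that [k.-1] is not truncated. *)
have dx0 : 0 < depth M (inord x) by apply: depth_gt0.
(* A lower cover [y] of [x] in [M] has depth [k]. The bottom and the labels from [m] on are deeper,
   so [y] is a nonzero element of [L] below the supposed atom [x]. *)
have [|y yx zy] := cover_above M_po (_ : strictly_below M (inord z) (inord x)).
  by rewrite -strictly_below_restriction.
have dy := depth_cover yx.
have y0 : 0 < y.
  rewrite lt0n; apply/eqP => y0.
  have : strictly_below M y a.
    have va : a = m :> nat := val_new.
    rewrite /strictly_below -val_eqE /= y0 va; case: (M_lat) => _ _ bot _.
    by rewrite bot // andbT; lia.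
  by move/(depth_lt M_po); lia.
have ltym : y < m.
  rewrite ltnNge leq_eqVlt; apply/negP => /orP[/eqP ay|ltay].
    have eay : a = y by apply: val_inj; rewrite val_new.
    by move: da; rewrite eay; lia.
  have : depth M a <= depth M y
    by apply: canonical_depth_le; rewrite // val_new ltay andbT ltnW.
  by lia.
have [y' ey] := inord_ord_surj mn' ltym; subst y.
have /andP[_ /forallP/(_ y')] := x_atom z erefl.
rewrite !strictly_below_restriction //; case/andP: yx => -> _; rewrite andbT.
rewrite /strictly_below zy andbT (inj_eq (inord_ord_inj mn')) => /negP[].
by rewrite -val_eqE eq_sym -lt0n; move: y0; rewrite (val_inord_ord mn').
Qed.

Lemma cover_set_A3 : cond_A3 L A.
Proof.
move=> x y xA yA nxy; have x0 := cover_set_gt0 xA; have y0 := cover_set_gt0 yA.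
case: (M_lat) => _ [[refl anti tr] meets joins] _ _.
have [w [wx wy wmax]] := meets (inord x) (inord y).
have [j xyj] := joins (inord x) (inord y).
rewrite !inE in xA yA; have /andP[/andP[_ ax] _] := xA; have /andP[/andP[_ ay] _] := yA.
have aw : a = w.
  apply/eqP; have aw := wmax _ ax ay; apply: contraNT nxy => naw.
  (* If [w] were not the new element, it would equal each of the two covers above it, but [x] and
     [y] differ. *)
  suff eqw (z : 'I_m) : covered_by M a (inord z) -> M w (inord z) -> w = inord z.
    by apply/eqP/(inord_ord_inj mn'); rewrite -(eqw x) // -(eqw y).
  case/andP=> _ /forallP/(_ w) nw wz; apply/eqP; apply: contraNT nw => nwz.
  by rewrite /strictly_below naw nwz aw wz.
(* The join covers [x] and [y] in [M]; being above the nonzero [x], it lies in [L]. *)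
subst w; have [xj yj] := M_sm (And3 wx wy wmax) xyj xA yA.
have /andP[/andP[_ /(restriction_up M_can mn' x0)[z ez _]] _] := xj; subst j.
by exists z; rewrite !covered_by_restriction.
Qed.

End LastAtom.

Theorem theorem3p6 (N : nat) (hN : 2 <= N) (M : rel 'I_N)
    (M_canonical : canonical M) (M_semimodular : semimodular M) :
  exists (L : forall m : nat, rel 'I_m) (A : forall m : nat, {set 'I_m}),
    [/\ L 2 =2 two_lattice,
        L N =2 M,
        forall m : nat, 2 <= m <= N -> canonical (L m) &
        forall m : nat, 2 <= m < N ->
          [/\ lattice_antichain (L m) (A m),
              cond_A1 (L m) (A m),
              cond_A2 (L m) (A m),
              cond_A3 (L m) (A m) &
              L m.+1 =2 extension (L m) (A m)]].
Proof.
case: N => [//|n] in hN M M_canonical M_semimodular *.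
exists (restriction M), (cover_set M); split.
- move=> x y; have [_ _ bot top] := M_canonical.1.
  have v := val_inord_ord hN; rewrite /restriction /two_lattice.
  have [x0|x0] := posnP x.
    have -> : x <= y by rewrite x0.
    by apply: bot; rewrite v.
  have [y0|y0] := posnP y; last first.
    have -> : x <= y by have := ltn_ord x; lia.
    by apply: top; rewrite v; have := ltn_ord y; lia.
  have -> : (x <= y) = false by lia.
  by apply/negP => /(le_bot M_canonical); rewrite !v => /(_ y0); lia.
- by move=> x y; rewrite /restriction !inord_val.
- by move=> m /andP[m2 mn]; apply: restriction_canonical.
move=> m /andP[m2 mn]; split.
- exact: cover_set_lattice_antichain.
- exact: cover_set_A1.
- exact: cover_set_A2.
- exact: cover_set_A3.
- exact: extension_cover_set.
Qed.
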